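(* Let $\{P_n\}_{n\ge 0}$ be a threefold symmetric monic $2$-orthogonal polynomial sequence, satisfying $P_0(x)=1$, $P_1(x)=x$, $P_2(x)=x^2$ and $P_{n+1}(x)=xP_n(x)-\gamma_{n-1}P_{n-2}(x)$ for $n\ge2$, with $\gamma_n\neq0$ for all $n\ge 1$. Put $$\vartheta_1=\frac{3(\gamma_1+\gamma_2)}{4\gamma_2},\qquad \vartheta_2=\frac{3(\gamma_1+\gamma_2)}{10\gamma_3}+\frac45 .$$ Then $\{P_n\}_{n\ge0}$ is Hahn-classical if and only if $\vartheta_1,\vartheta_2\notin\{\frac{n-1}{n}: n\ge 1\}$ and, for every $n\ge 1$, $P_n$ satisfies $$(a_nx^3-b_n)P_n'''+c_nx^2P_n''+d_nxP_n'=e_nP_n,$$ where \begin{align*} a_n&=(\vartheta_n-1)(\vartheta_{n+1}-1),\\ b_n&=\frac{\gamma_n\big((n-1)\vartheta_{n-1}-n+2\big)\big(n\vartheta_n-n+1\big)\big((n+1)\vartheta_{n+1}-n\big)}{n(n+1)},\\ c_n&=\vartheta_n\vartheta_{n+1}-1-(n-3)(\vartheta_n-1)(\vartheta_{n+1}-1),\\ d_n&=n\vartheta_{n+1}-(n-1)\vartheta_n(2\vartheta_{n+1}-1),\\ e_n&=n\vartheta_{n+1}, \end{align*} and $$\vartheta_n=\left(\frac{1-(-1)^n}{2}\right)\frac{1-\frac{n+1}{2}(1-\vartheta_1)}{1-\frac{n-1}{2}(1-\vartheta_1)}+\left(\frac{1+(-1)^n}{2}\right)\frac{1-\frac n2(1-\vartheta_2)}{1-(\frac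 n2-1)(1-\vartheta_2)},\qquad n\ge 1$$ (for $n=1$ the term $(n-1)\vartheta_{n-1}$ in $b_1$ is read as $0$).
   Context: A sequence of monic polynomials $\{P_n\}_{n\ge0}$ ($\deg P_n=n$) is $2$-orthogonal if there are linear functionals $u_0,u_1$ on polynomials such that, for all $m,n\ge 0$: $\langle u_0,x^mP_n\rangle=0$ if $n\ge 2m+1$ and $\langle u_0,x^mP_{2m}\rangle\neq 0$; $\langle u_1,x^mP_n\rangle=0$ if $n\ge 2m+2$ and $\langle u_1,x^mP_{2m+1}\rangle\ne 0$. It is threefold symmetric if $P_n(\omega x)=\omega^nP_n(x)$ for all $n\ge 0$ with $\omega=e^{2\pi i/3}$; a $2$-orthogonal sequence is threefold symmetric exactly when it satisfies a recurrence $P_{n+1}=xP_n-\gamma_{n-1}P_{n-2}$ $(n\ge2)$, $P_k=x^k$ $(k=0,1,2)$, with all $\gamma_n\ne0$. A monic $2$-orthogonal sequence $\{P_n\}_{n\ge0}$ is Hahn-classical if the sequence $Q_n(x)=\frac1{n+1}P_{n+1}'(x)$, $n\ge 0$, is also $2$-orthogonal. *)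

(* Defs.v *)
From HB Require Import structures.
From mathcomp Require Import all_boot all_order all_algebra.
From mathcomp Require Import complex.
From mathcomp Require Import reals trigo.

Set Implicit Arguments.
Unset Strict Implicit.
Unset Printing Implicit Defensive.

Import Order.TTheory GRing.Theory Num.Theory.

Local Open Scope ring_scope.

Definition monic_seq (K : fieldType) (P : nat -> {poly K}) : Prop :=
  forall n : nat, P n \is monic /\ size (P n) = n.+1.

Definition two_orthogonal (K : fieldType) (P : nat -> {poly K}) : Prop :=
  monic_seq P /\
  exists u0 u1 : {scalar {poly K}}, forall m : nat,
    [/\ forall n : nat, (2 * m + 1 <= n)%N -> u0 ('X^m * P n) = 0,
        u0 ('X^m * P (2 * m)%N) != 0,
        forall n : nat, (2 * m + 2 <= n)%N -> u1 ('X^m * P n) = 0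
      & u1 ('X^m * P (2 * m + 1)%N) != 0].

Definition derivative_seq (K : fieldType) (P : nat -> {poly K})
    (n : nat) : {poly K} :=
  (n.+1)%:R^-1 *: (P n.+1)^`().

Definition hahn_classical (K : fieldType) (P : nat -> {poly K}) : Prop :=
  two_orthogonal P /\ two_orthogonal (derivative_seq P).

(* e^{2 pi i / 3} in Cartesian form *)
Definition omega (R : realType) : R[i] :=
  Complex (cos (2 * pi / 3)) (sin (2 * pi / 3)).

Definition threefold_symmetric (R : realType) (P : nat -> {poly R[i]}) : Prop :=
  forall n : nat, P n \Po (omega R *: 'X) = omega R ^+ n *: P n.

(* gamma 0 is a dummy value: the coefficients are gamma 1, gamma 2, ... *)
Definition threefold_recurrence (K : fieldType) (P : nat -> {poly K})
    (gamma : nat -> K) : Prop :=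
  [/\ P 0%N = 1, P 1%N = 'X, P 2%N = 'X^2
    & forall n : nat, (2 <= n)%N ->
        P n.+1 = 'X * P n - gamma (n - 1)%N *: P (n - 2)%N].

Section Coefficients.
Variables (K : fieldType) (gamma : nat -> K).

Definition theta1 : K := 3 * (gamma 1%N + gamma 2%N) / (4 * gamma 2%N).

Definition theta2 : K :=
  3 * (gamma 1%N + gamma 2%N) / (10 * gamma 3%N) + 4 / 5.

(* The summand of the wrong parity is killed by its zero factor, even when its
   denominator vanishes. *)
Definition theta (n : nat) : K :=
  (1 - (-1) ^+ n) / 2 *
    ((1 - (n%:R + 1) / 2 * (1 - theta1)) /
     (1 - (n%:R - 1) / 2 * (1 - theta1))) +
  (1 + (-1) ^+ n) / 2 *
    ((1 - n%:R / 2 * (1 - theta2)) /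
     (1 - (n%:R / 2 - 1) * (1 - theta2))).

Definition coef_a (n : nat) : K := (theta n - 1) * (theta n.+1 - 1).

(* For n = 1, theta (n - 1) = theta 0 is multiplied by 0. *)
Definition coef_b (n : nat) : K :=
  gamma n * ((n%:R - 1) * theta (n - 1)%N - n%:R + 2)
          * (n%:R * theta n - n%:R + 1)
          * ((n%:R + 1) * theta n.+1 - n%:R)
  / (n%:R * (n%:R + 1)).

Definition coef_c (n : nat) : K :=
  theta n * theta n.+1 - 1 - (n%:R - 3) * (theta n - 1) * (theta n.+1 - 1).

Definition coef_d (n : nat) : K :=
  n%:R * theta n.+1 - (n%:R - 1) * theta n * (2 * theta n.+1 - 1).

Definition coef_e (n : nat) : K := n%:R * theta n.+1.

End Coefficients.

Definition excluded_value (K : fieldType) (t : K) : Prop :=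
  exists n : nat, (1 <= n)%N /\ t = (n%:R - 1) / n%:R.

(* Main.v *)
(* Hahn-classicality means that [Q_n = P_{n+1}' / (n+1)] again satisfies a
   recurrence [Q_{n+1} = x Q_n - g_{n-1} Q_{n-2}] with nonzero coefficients,
   which we write as [g_m = m / (m+2) gamma_{m+1} th_m].  Eliminating [P_{n+1}']
   with the derivative of the recurrence of [P] turns this into the first-order
   relation
     [n P_n - x P_n' = - gamma_{n-1} ((n+1) th_{n-2} - n) P_{n-2}'].
   Comparing its coefficients of [x^{n-3}] and [x^{n-6}] with those of the
   recurrence gives [th_1 = theta_1], [th_2 = theta_2],
   [th_{m+2} = 2 - 1 / th_m], which is a Moebius iteration solved by the closed
   form of [theta] (it never hits 0 exactly when [theta_1], [theta_2] are not
   excluded), and a first-order recursion for [gamma].  Composing the relation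
   with two uses of the recurrence expresses the coefficient of [x^k] in [P_n]
   through that of [x^{k+3}], and this two-term relation is the differential
   equation.  Conversely, the differential equation at [x^{n-3}] determines
   [gamma_n] and gives back the recursion for [gamma], from which the
   first-order relation follows by induction on [n]. *)

Require Import Defs.
From HB Require Import structures.
From mathcomp Require Import all_boot all_order all_algebra.
From mathcomp Require Import complex.
From mathcomp Require Import reals trigo.
From mathcomp Require Import ring zify.

Set Implicit Arguments.
Unset Strict Implicit.
Unset Printing Implicit Defensive.

Import Order.TTheory GRing.Theory Num.Theory.

Local Open Scope ring_scope.

(** * Threefold recurrences and 2-orthogonality *)

Section MomentFunctional.
Variables (K : fieldType) (mu : nat -> K).

Definition moment_functional (p : {poly K}) : K := \sum_(i < size p) p`_i * mu i.

Lemma moment_functional_widen n (p : {poly K}) :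
  (size p <= n)%N -> moment_functional p = \sum_(i < n) p`_i * mu i.
Proof.
move=> le_pn; rewrite /moment_functional (big_ord_widen _ (fun i => p`_i * mu i) le_pn).
rewrite big_mkcond; apply: eq_bigr => i _; case: ltnP => // le_pi.
by rewrite nth_default // mul0r.
Qed.

Lemma moment_functional_is_scalar : scalar moment_functional.
Proof.
move=> a p q; set n := maxn (size p) (size q).
rewrite !(@moment_functional_widen n) ?leq_maxl ?leq_maxr //; last first.
  rewrite (leq_trans (size_polyD _ _)) // geq_max leq_maxr andbT.
  by rewrite (leq_trans (size_scale_leq _ _)) ?leq_maxl.
rewrite mulr_sumr -big_split /=; apply: eq_bigr => i _.
by rewrite coefD coefZ mulrDl mulrA.
Qed.

HB.instance Definition _ :=
  GRing.isLinear.Build K {poly K} K _ moment_functional moment_functional_is_scalar.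

Lemma moment_functionalXn n : moment_functional 'X^n = mu n.
Proof.
rewrite (@moment_functional_widen n.+1) ?size_polyXn // big_ord_recr /= coefXn eqxx mul1r.
by rewrite big1 ?add0r // => i _; rewrite coefXn ltn_eqF // mul0r.
Qed.

End MomentFunctional.

Section Favard.
Variable K : fieldType.
Implicit Types (P Q : nat -> {poly K}) (g : nat -> K).

(* [mixed_moment g j m n] is [u_j (x^m P_n)] for the functional [u_j] dual to
   [P_j]; its recursion is [x P_n = P_{n+1} + g_{n-1} P_{n-2}]. *)
Fixpoint mixed_moment g (j m n : nat) : K :=
  if m is m'.+1 then
    mixed_moment g j m' n.+1
    + (if n is n'.+2 then g n'.+1 * mixed_moment g j m' n' else 0)
  else (n == j)%:R.

(** Each multiplication by x raises the index by one or lowers it by two, so m of them cannot lead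
    from n > 2m + j down to j. *)
Lemma mixed_moment_eq0 g j m n :
  (2 * m + j < n)%N -> mixed_moment g j m n = 0.
Proof.
elim: m n => [|m IH] n ltn /=; first by rewrite gtn_eqF.
rewrite IH; last by lia.
case: n ltn => [|[|n]] ltn; rewrite ?addr0 // IH; last by lia.
by rewrite mulr0 addr0.
Qed.

(** Only m lowerings in a row lead from 2m + j to j, so the value is a product of m coefficients
    [g]. *)
Lemma mixed_moment_neq0 g j m :
  (forall n, (1 <= n)%N -> g n != 0) -> mixed_moment g j m (2 * m + j) != 0.
Proof.
move=> g_neq0; elim: m => [|m IH]; first by rewrite /= eqxx oner_neq0.
rewrite mulnS !addSn /= mixed_moment_eq0 ?add0r; last by lia.
by rewrite mulf_neq0 // g_neq0.
Qed.

Lemma threefold_recurrenceS P g n : threefold_recurrence P g ->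
  P n.+3 = 'X * P n.+2 - g n.+1 *: P n.
Proof. by case=> _ _ _ /(_ n.+2 isT) ->; rewrite !subSS !subn0. Qed.

(** Solved for P_{n+3}, the recurrence is that of [mixed_moment]; P_0, P_1, P_2 are powers of x, and
    no lowering occurs below index 2. *)
Lemma mixed_momentE P g j m n : threefold_recurrence P g ->
  moment_functional (fun i => mixed_moment g j i 0) ('X^m * P n) = mixed_moment g j m n.
Proof.
move=> P_rec; elim/ltn_ind: n m => n IH m; case: (P_rec) => P0 P1 P2 _.
case: n IH => [|[|[|n]]] IH.
- by rewrite P0 mulr1 moment_functionalXn.
- by rewrite P1 -exprSr moment_functionalXn /= addr0.
- by rewrite P2 -exprD addn2 moment_functionalXn /= !addr0.
rewrite (threefold_recurrenceS _ P_rec) mulrBr mulrA -exprSr -scalerAr linearB linearZ /=.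
by rewrite !IH //= ?addrK //; lia.
Qed.

Lemma threefold_recurrence_monic P g : threefold_recurrence P g -> monic_seq P.
Proof.
move=> P_rec; elim/ltn_ind=> n IH; case: (P_rec) => P0 P1 P2 _.
case: n IH => [|[|[|n]]] IH; rewrite ?P0 ?P1 ?P2 ?monic1 ?monicX ?monicXn
  ?size_poly1 ?size_polyX ?size_polyXn //.
rewrite (threefold_recurrenceS _ P_rec) mulrC.
have [mP2 sP2] := IH n.+2 (leqnn _); have [_ sP] := IH n (leqW (leqnSn _)).
have sX : size (P n.+2 * 'X) = n.+4.
  by rewrite size_mulX ?sP2 // monic_neq0.
have lt_s : (size (- (g n.+1 *: P n)) < size (P n.+2 * 'X)%R)%N.
  by rewrite size_polyN sX (leq_ltn_trans (size_scale_leq _ _)) // sP; lia.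
by rewrite monicE lead_coefDl // size_polyDl // lead_coefMX sX -monicE.
Qed.

Theorem threefold_recurrence_two_orthogonal P g :
  threefold_recurrence P g -> (forall n, (1 <= n)%N -> g n != 0) -> two_orthogonal P.
Proof.
move=> P_rec g_neq0; split; first exact: threefold_recurrence_monic P_rec.
(* The functionals dual to P_0 and P_1, given by their moments. *)
exists (moment_functional (fun i => mixed_moment g 0 i 0)).
exists (moment_functional (fun i => mixed_moment g 1 i 0)) => m.
split=> [n le_n||n le_n|]; rewrite /= (mixed_momentE _ _ _ P_rec).
- by rewrite mixed_moment_eq0 //; lia.
- by have := mixed_moment_neq0 0 m g_neq0; rewrite addn0.
- by rewrite mixed_moment_eq0 //; lia.
- exact: mixed_moment_neq0.
Qed.

Lemma monic_seq_expand Q n (p : {poly K}) : monic_seq Q -> (size p <= n)%N ->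
  exists c : nat -> K, p = \sum_(k < n) c k *: Q k.
Proof.
move=> mQ; elim: n p => [|n IH] p sp.
  by exists (fun=> 0); rewrite big_ord0; apply/eqP; rewrite -size_poly_leq0.
have [mQn sQn] := mQ n.
have sp' : (size (p - p`_n *: Q n)%R <= n)%N.
  apply/leq_sizeP => j; rewrite leq_eqVlt => /predU1P[<-|lt_nj].
    rewrite coefB coefZ; have /eqP := mQn; rewrite /lead_coef sQn /= => ->.
    by rewrite mulr1 subrr.
  by rewrite coefB coefZ (nth_default _ (leq_trans sp lt_nj)) [X in _ * X]nth_default
    ?sQn // mulr0 subrr.
have [c pE] := IH _ sp'; exists (fun k => if (k < n)%N then c k else p`_n).
rewrite big_ord_recr /= ltnn; under eq_bigr => i _ do rewrite ltn_ord.
by rewrite -pE subrK.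
Qed.

(* The values [u0 (x^m p)] and [u1 (x^m p)], taken alternately, form a
   triangular system in the coordinates of [p]. *)
Lemma two_orthogonal_eq0 Q n (p : {poly K}) (u0 u1 : {scalar {poly K}}) :
  monic_seq Q ->
  (forall m : nat,
    [/\ forall n : nat, (2 * m + 1 <= n)%N -> u0 ('X^m * Q n) = 0,
        u0 ('X^m * Q (2 * m)%N) != 0,
        forall n : nat, (2 * m + 2 <= n)%N -> u1 ('X^m * Q n) = 0
      & u1 ('X^m * Q (2 * m + 1)%N) != 0]) ->
  (size p <= n)%N ->
  (forall m, (2 * m < n)%N -> u0 ('X^m * p) = 0) ->
  (forall m, (2 * m + 1 < n)%N -> u1 ('X^m * p) = 0) ->
  p = 0.
Proof.
move=> mQ orth sp u0p u1p; have [c pE] := monic_seq_expand mQ sp.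
have uE (u : {scalar {poly K}}) m :
    u ('X^m * p) = \sum_(k < n) c k * u ('X^m * Q k).
  rewrite pE mulr_sumr linear_sum; apply: eq_bigr => k _.
  by rewrite -scalerAr linearZ.
suff c0 k : (k < n)%N -> c k = 0.
  by rewrite pE big1 // => k _; rewrite c0 // scale0r.
elim/ltn_ind: k => k IH ltkn.
(* Coordinates below k vanish by induction, those above by orthogonality: one functional isolates
   [c k]. *)
have pick (u : {scalar {poly K}}) m :
    (forall l, (k < l)%N -> u ('X^m * Q l) = 0) ->
    u ('X^m * p) = c k * u ('X^m * Q k).
  move=> u0l; rewrite uE (bigD1 (Ordinal ltkn)) //= big1 ?addr0 // => i.
  rewrite -val_eqE /= neq_ltn => /orP[lt_ik|lt_ki]; last by rewrite u0l ?mulr0.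
  by rewrite IH ?mul0r.
have [o0 n0 o1 n1] := orth k./2.
case: (boolP (odd k)) => [odd_k|even_k].
  have kE : k = (2 * k./2 + 1)%N by have := odd_double_half k; rewrite odd_k; lia.
  have /eqP := pick u1 k./2 (fun l ltl => o1 l ltac:(lia)).
  rewrite u1p; last by lia.
  by rewrite -kE in n1; rewrite eq_sym mulf_eq0 (negPf n1) orbF => /eqP.
have kE : k = (2 * k./2)%N.
  by have := odd_double_half k; rewrite (negPf even_k); lia.
have /eqP := pick u0 k./2 (fun l ltl => o0 l ltac:(lia)).
rewrite u0p; last by lia.
by rewrite -kE in n0; rewrite eq_sym mulf_eq0 (negPf n0) orbF => /eqP.
Qed.

End Favard.

(** * The recurrence forced by 2-orthogonality *)

Section Recurrence.
Variable K : fieldType.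
Implicit Types (P Q : nat -> {poly K}) (g : nat -> K).

Lemma monic_seq_coef Q n : monic_seq Q -> (Q n)`_n = 1.
Proof.
by move=> /(_ n) [mQ sQ]; move: mQ; rewrite monicE /lead_coef sQ => /eqP.
Qed.

Lemma monic_seq_coef0 Q n k : monic_seq Q -> (n < k)%N -> (Q n)`_k = 0.
Proof. by move=> /(_ n) [_ sQ] lt_nk; rewrite nth_default // sQ. Qed.

(* The two vanishing conditions are what remains of threefold symmetry: they
   kill the terms [Q_n] and [Q_{n-1}] of the four-term recurrence. *)
Theorem two_orthogonal_recurrence Q :
  two_orthogonal Q -> (forall n, (Q n.+1)`_n = 0) -> (forall n, (Q n.+2)`_n = 0) ->
  exists2 g, threefold_recurrence Q g & forall n, (1 <= n)%N -> g n != 0.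
Proof.
move=> [mQ [u0 [u1 orth]]] Q1 Q2.
have Q_lead n : (Q n)`_n = 1 by exact: monic_seq_coef.
have Q_gt n k : (n < k)%N -> (Q n)`_k = 0 by exact: monic_seq_coef0.
(* The only candidate, read off at x^{n-1}; [g 0] is a dummy value. *)
pose g n := ('X * Q n.+1 - Q n.+2)`_n.-1.
have recE n : 'X * Q n.+2 - Q n.+3 = g n.+1 *: Q n.
  apply/eqP; rewrite -subr_eq0; apply/eqP.
  apply: (two_orthogonal_eq0 (n := n) mQ orth).
  - apply/leq_sizeP => j; rewrite leq_eqVlt => /predU1P[<-|].
      by rewrite coefB coefZ Q_lead mulr1 subrr.
    case: j => // j; rewrite ltnS leq_eqVlt => /predU1P[<-|].
      by rewrite !coefE /= !Q2 Q_gt // mulr0 !subrr.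
    rewrite leq_eqVlt => /predU1P[<-|].
      by rewrite !coefE /= !Q1 Q_gt // mulr0 !subrr.
    rewrite leq_eqVlt => /predU1P[<-|lt_j].
      by rewrite !coefE /= !Q_lead Q_gt ?mulr0 ?subrr //; lia.
    by rewrite !coefE /= !Q_gt ?mulr0 ?subrr //; lia.
  - move=> m lt_m; have [o0 _ _ _] := orth m; have [o0' _ _ _] := orth m.+1.
    rewrite !mulrBr mulrA -exprSr -scalerAr !linearB linearZ /=.
    by rewrite o0' ?o0 ?mulr0 ?subrr //; lia.
  - move=> m lt_m; have [_ _ o1 _] := orth m; have [_ _ o1' _] := orth m.+1.
    rewrite !mulrBr mulrA -exprSr -scalerAr !linearB linearZ /=.
    by rewrite o1' ?o1 ?mulr0 ?subrr //; lia.
exists g; first split.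
- apply/polyP=> -[|k]; rewrite coef1 ?Q_lead //.
  by rewrite Q_gt.
- apply/polyP=> -[|[|k]]; rewrite coefX ?Q1 ?Q_lead //.
  by rewrite Q_gt.
- apply/polyP=> -[|[|[|k]]]; rewrite coefXn ?Q1 ?Q2 ?Q_lead //.
  by rewrite Q_gt.
- case=> [|[|n]] // _; rewrite !subSS !subn0 -recE; ring.
(* If g_{n+1} = 0, then x Q_{n+2} = Q_{n+3}, which identifies a value of u_0 or u_1 that must be
   nonzero with one that must vanish. *)
case=> // n _; apply/eqP => gn0.
have XQ : 'X * Q n.+2 = Q n.+3.
  by apply/eqP; rewrite -subr_eq0 recE gn0 scale0r.
have XE h : 'X^(h.+1) * Q n.+2 = 'X^h * Q n.+3 by rewrite exprSr -mulrA XQ.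
have [o0 _ o1 _] := orth n./2; have [_ n0 _ n1] := orth n./2.+1.
case: (boolP (odd n)) => [odd_n|even_n].
  have nE : n.+2 = (2 * n./2.+1 + 1)%N by have := odd_double_half n; rewrite odd_n; lia.
  by case/eqP: n1; rewrite -nE XE o1 //; lia.
have nE : n.+2 = (2 * n./2.+1)%N.
  by have := odd_double_half n; rewrite (negPf even_n); lia.
by case/eqP: n0; rewrite -nE XE o0 //; lia.
Qed.

Lemma threefold_recurrence_coefS P g n k : threefold_recurrence P g ->
  (P n.+3)`_k.+1 = (P n.+2)`_k - g n.+1 * (P n)`_k.+1.
Proof. by move=> /(threefold_recurrenceS n)->; rewrite !coefE. Qed.

Lemma threefold_recurrence_coef0 P g n : threefold_recurrence P g ->
  (P n.+3)`_0 = - g n.+1 * (P n)`_0.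
Proof. by move=> /(threefold_recurrenceS n)->; rewrite !coefE /= sub0r mulNr. Qed.

(** Exponents drop in steps of three; these two gaps pass to the derivatives, as
    [two_orthogonal_recurrence] requires. *)
Lemma threefold_recurrence_subleading P g n : threefold_recurrence P g ->
  (P n.+1)`_n = 0 /\ (P n.+2)`_n = 0.
Proof.
move=> P_rec; have mP := threefold_recurrence_monic P_rec.
case: (P_rec) => P0 P1 P2 _.
elim: n => [|n [IH1 IH2]]; first by rewrite P1 P2 coefX coefXn.
have P1n : (P n.+2)`_n.+1 = 0.
  case: n {IH2} IH1 => [|n] IH1; first by rewrite P2 coefXn.
  by rewrite (threefold_recurrence_coefS _ _ P_rec) IH1 monic_seq_coef0 ?mulr0 ?subrr.
split=> //; rewrite (threefold_recurrence_coefS _ _ P_rec) IH2.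
by rewrite monic_seq_coef0 ?mulr0 ?subrr.
Qed.

End Recurrence.

(** Derives an equation from a known one through an explicit cofactor [c], leaving an identity for
    [ring] or [field]. *)
Lemma eq_multiple (F : numFieldType) (c x y a b : F) :
  x = y -> a - b = c * (x - y) -> a = b.
Proof. by move=> ->; rewrite subrr mulr0 => /eqP; rewrite subr_eq0 => /eqP. Qed.

Lemma eq_multiple2 (F : numFieldType) (c d x y z t a b : F) :
  x = y -> z = t -> a - b = c * (x - y) + d * (z - t) -> a = b.
Proof.
by move=> -> ->; rewrite !subrr !mulr0 addr0 => /eqP; rewrite subr_eq0 => /eqP.
Qed.

(** * The Moebius iteration solved by theta *)

Section Theta.
Variable K : numFieldType.

(** x = (k-1)/k means k(1-x) = 1; the case k = 0 only says 1 != 0. *)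
Lemma not_excludedP (x : K) :
  ~ excluded_value x <-> forall k : nat, 1 - k%:R * (1 - x) != 0.
Proof.
split=> [nx [|k]|nx [[|n] [//= _ xE]]]; first by rewrite mul0r subr0 oner_neq0.
  apply/eqP => k0; apply: nx; exists k.+1; split=> //.
  have k1 : k.+1%:R != 0 :> K by rewrite pnatr_eq0.
  apply: (mulIf k1); rewrite divfK //.
  by apply: (eq_multiple (c := 1) k0); ring.
case/eqP: (nx n.+1); rewrite xE mulrBr mulrCA divff ?pnatr_eq0 //; ring.
Qed.

(** Iterates of y -> 2 - 1/y from x; away from the fixed point 1, this map translates 1/(1-y) by
    -1. *)
Definition moebius_orbit (x : K) (k : nat) : K :=
  (1 - k.+1%:R * (1 - x)) / (1 - k%:R * (1 - x)).

Lemma moebius_orbit0 x : moebius_orbit x 0 = x.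
Proof. by rewrite /moebius_orbit mul0r subr0 divr1; ring. Qed.

Lemma moebius_orbit_neq0 x k :
  ~ excluded_value x -> moebius_orbit x k != 0.
Proof. by move=> /not_excludedP nx; rewrite mulf_neq0 ?invr_neq0. Qed.

Lemma moebius_orbitS x k : ~ excluded_value x ->
  moebius_orbit x k.+1 * moebius_orbit x k = 2 * moebius_orbit x k - 1.
Proof.
move=> /not_excludedP nx; rewrite /moebius_orbit.
by field; rewrite nat1r !nx.
Qed.

(** Over the common denominator the numerator is 1 - (c+k)(1-x); [j] stands for c + k as a natural
    number. *)
Lemma moebius_orbit_shift_neq0 x k j (c : K) : ~ excluded_value x ->
  c * (1 - k.+1%:R * (1 - x)) - (c - 1) * (1 - k%:R * (1 - x)) = 1 - j%:R * (1 - x) ->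
  c * moebius_orbit x k - (c - 1) != 0.
Proof.
move=> /not_excludedP nx E.
have -> : c * moebius_orbit x k - (c - 1) = (1 - j%:R * (1 - x)) / (1 - k%:R * (1 - x)).
  by rewrite -E /moebius_orbit; field; exact: nx.
by rewrite mulf_neq0 ?invr_neq0.
Qed.

(** The numerator at k is the denominator at k+1, so the nonvanishing of [y] keeps every denominator
    nonzero. *)
Lemma moebius_orbit_unique x (y : nat -> K) :
  y 0%N = x -> (forall k, y k != 0) -> (forall k, y k.+1 * y k = 2 * y k - 1) ->
  ~ excluded_value x /\ forall k, y k = moebius_orbit x k.
Proof.
move=> y0 y_neq0 yS.
suff H k : 1 - k%:R * (1 - x) != 0 /\ y k = moebius_orbit x k.
  by split=> [|k]; [apply/not_excludedP => k|]; case: (H k).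
elim: k => [|k [nk yk]].
  by rewrite /moebius_orbit mul0r subr0 oner_neq0 mul1r y0; split=> //; field.
have nk1 : 1 - k.+1%:R * (1 - x) != 0.
  by apply: contra_neq (y_neq0 k) => k1; rewrite yk /moebius_orbit k1 mul0r.
split=> //; apply: (mulIf (y_neq0 k)); rewrite yS yk /moebius_orbit.
by field; rewrite nat1r nk nk1.
Qed.

Variable gamma : nat -> K.

Lemma theta_odd k : theta gamma k.*2.+1 = moebius_orbit (theta1 gamma) k.
Proof.
rewrite /theta exprS -signr_odd odd_double expr0 /moebius_orbit -mul2n.
rewrite [(1 + -1 * 1) / 2](_ : _ = 0) ?mul0r ?addr0; last by ring.
rewrite [(1 - -1 * 1) / 2](_ : _ = 1) ?mul1r; last by field.
by congr (_ / _); field.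
Qed.

Lemma theta_even k : theta gamma k.*2.+2 = moebius_orbit (theta2 gamma) k.
Proof.
rewrite /theta 2!exprS -signr_odd odd_double expr0 /moebius_orbit -mul2n.
rewrite [(1 - -1 * (-1 * 1)) / 2](_ : _ = 0) ?mul0r ?add0r; last by ring.
rewrite [(1 + -1 * (-1 * 1)) / 2](_ : _ = 1) ?mul1r; last by field.
by congr (_ / _); field.
Qed.

Definition theta_recursion (th : nat -> K) : Prop :=
  forall m, (1 <= m)%N -> th m.+2 * th m = 2 * th m - 1.

Lemma odd_even_ind (Q : nat -> Prop) :
  (forall k, Q k.*2.+1) -> (forall k, Q k.*2.+2) -> forall m, (1 <= m)%N -> Q m.
Proof.
move=> Qodd Qeven [//|m] _; rewrite -(odd_double_half m).
by case: (odd m) => /=; [apply: Qeven|apply: Qodd].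
Qed.

Lemma theta_unique (th : nat -> K) :
  th 1%N = theta1 gamma -> th 2%N = theta2 gamma ->
  (forall m, (1 <= m)%N -> th m != 0) -> theta_recursion th ->
  [/\ ~ excluded_value (theta1 gamma), ~ excluded_value (theta2 gamma)
    & forall m, (1 <= m)%N -> th m = theta gamma m].
Proof.
move=> th1 th2 th_neq0 thS.
have [k|k|n1 odd_th] := @moebius_orbit_unique (theta1 gamma) (fun k => th k.*2.+1) th1.
- exact: th_neq0.
- exact: thS.
have [k|k|n2 even_th] := @moebius_orbit_unique (theta2 gamma) (fun k => th k.*2.+2) th2.
- exact: th_neq0.
- exact: thS.
split=> //; apply: odd_even_ind => k; first by rewrite odd_th theta_odd.
by rewrite even_th theta_even.
Qed.

Hypothesis n1 : ~ excluded_value (theta1 gamma).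
Hypothesis n2 : ~ excluded_value (theta2 gamma).

Lemma theta_neq0 m : (1 <= m)%N -> theta gamma m != 0.
Proof.
by move: m; apply: odd_even_ind => k; rewrite (theta_odd, theta_even) moebius_orbit_neq0.
Qed.

Lemma thetaS : theta_recursion (theta gamma).
Proof.
apply: odd_even_ind => k; rewrite -doubleS.
  by rewrite !theta_odd moebius_orbitS.
by rewrite !theta_even moebius_orbitS.
Qed.

(** With [theta_shift3_neq0], supplies the divisors for the way back from the differential
    equation. *)
Lemma theta_shift0_neq0 m : (1 <= m)%N -> m%:R * theta gamma m - (m%:R - 1) != 0.
Proof.
move: m; apply: odd_even_ind => k; rewrite (theta_odd, theta_even).
  by apply: (@moebius_orbit_shift_neq0 _ _ (3 * k + 1)) => //; rewrite -mul2n; ring.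
by apply: (@moebius_orbit_shift_neq0 _ _ (3 * k + 2)) => //; rewrite -mul2n; ring.
Qed.

Lemma theta_shift3_neq0 m :
  (1 <= m)%N -> (m%:R + 3) * theta gamma m - (m%:R + 2) != 0.
Proof.
have -> : m%:R + 2 = (m%:R + 3) - 1 :> K by ring.
move: m; apply: odd_even_ind => k; rewrite (theta_odd, theta_even).
  by apply: (@moebius_orbit_shift_neq0 _ _ (3 * k + 4)) => //; rewrite -mul2n; ring.
by apply: (@moebius_orbit_shift_neq0 _ _ (3 * k + 5)) => //; rewrite -mul2n; ring.
Qed.

End Theta.

(** * The first-order relation between P and its derivatives *)

Section StructureRelation.
Variables (K : numFieldType) (P : nat -> {poly K}) (gamma : nat -> K).
Hypothesis P_rec : threefold_recurrence P gamma.
Hypothesis gamma_neq0 : forall n : nat, (1 <= n)%N -> gamma n != 0.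

Let mP : monic_seq P := threefold_recurrence_monic P_rec.
Let coefS n k := threefold_recurrence_coefS n k P_rec.

Lemma coef_derivative_seq n k :
  (derivative_seq P n)`_k = k.+1%:R / n.+1%:R * (P n.+1)`_k.+1.
Proof. by rewrite coefZ coef_deriv -mulr_natr; ring. Qed.

Lemma coefX_derivative_seq n k :
  ('X * derivative_seq P n)`_k = k%:R / n.+1%:R * (P n.+1)`_k.
Proof.
by rewrite coefXM; case: k => [|k]; rewrite ?mul0r //= coef_derivative_seq.
Qed.

(* Coefficientwise form of
   [n P_n - x P_n' = - c_n P_{n-2}'] for [n = m + 2] and
   [c_n = gamma_{n-1} ((n+1) th_{n-2} - n)]. *)
Definition structure_relation (th : nat -> K) : Prop :=
  forall m k, (1 <= m)%N ->
    (m%:R + 2 - k%:R) * (P m.+2)`_k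
    + k.+1%:R * gamma m.+1 * ((m%:R + 3) * th m - (m%:R + 2)) * (P m)`_k.+1 = 0.

(** In Q_{m+2} = x Q_{m+1} - g_m Q_{m-1}, the recurrence of P removes P_{m+3} and leaves P_{m+2} and
    P_m. *)
Lemma derivative_recurrence_structure g :
  threefold_recurrence (derivative_seq P) g ->
  structure_relation (fun m => (m%:R + 2) * g m / (m%:R * gamma m.+1)).
Proof.
move=> Q_rec [//|m] k _.
have := threefold_recurrenceS m Q_rec => /(congr1 (fun p : {poly K} => p`_k)).
rewrite coef_derivative_seq coefB coefX_derivative_seq coefZ coef_derivative_seq.
rewrite coefS => E.
have g0 := gamma_neq0 (isT : 1 <= m.+2)%N.
apply: (eq_multiple (c := m.+4%:R * m.+3%:R) E); field.
by rewrite nat1r -!natrD !pnatr_eq0 g0.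
Qed.

Lemma structure_derivative_recurrence th : structure_relation th ->
  threefold_recurrence (derivative_seq P)
    (fun m => m%:R * gamma m.+1 * th m / (m%:R + 2)).
Proof.
move=> T; case: (P_rec) => P0 P1 P2 _.
have P3 := threefold_recurrenceS 0 P_rec; rewrite P0 P2 in P3.
split.
- rewrite /derivative_seq P1 derivX invr1 scale1r //.
- rewrite /derivative_seq P2 derivXn /= -scaler_nat scalerA mulVf ?scale1r ?pnatr_eq0 //.
- rewrite /derivative_seq P3 -exprS derivB derivXn derivZ derivC scaler0 subr0 /=.
  by rewrite -scaler_nat scalerA mulVf ?scale1r ?pnatr_eq0.
case=> [|[|m]] // _; rewrite !subSS !subn0; apply/polyP=> k.
rewrite coef_derivative_seq coefB coefX_derivative_seq coefZ coef_derivative_seq coefS.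
have E := T m.+1 k isT.
apply: (eq_multiple (c := (m.+4%:R * m.+3%:R)^-1) E); field.
by rewrite nat1r -!natrD !pnatr_eq0.
Qed.

(** Both directions pass through the recurrence of the derivatives, whose coefficients are nonzero
    exactly when [th] is. *)
Theorem hahn_classicalP : two_orthogonal P ->
  hahn_classical P <->
  exists2 th, structure_relation th & forall m, (1 <= m)%N -> th m != 0.
Proof.
move=> P_orth; split=> [[_ Q_orth]|[th T th_neq0]].
  have sub n := threefold_recurrence_subleading n P_rec.
  have [||g Q_rec g_neq0] := two_orthogonal_recurrence Q_orth.
  - by move=> n; rewrite coef_derivative_seq (sub n.+1).1 mulr0.
  - by move=> n; rewrite coef_derivative_seq (sub n.+1).2 mulr0.
  exists (fun m => (m%:R + 2) * g m / (m%:R * gamma m.+1)).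
    exact: derivative_recurrence_structure.
  move=> m m1; rewrite !mulf_neq0 ?invr_neq0 ?mulf_neq0 ?gamma_neq0 ?g_neq0 //.
    by rewrite -natrD pnatr_eq0 addn2.
  by rewrite pnatr_eq0 -lt0n.
split=> //; apply: threefold_recurrence_two_orthogonal.
  exact: structure_derivative_recurrence T.
move=> m m1; rewrite !mulf_neq0 ?invr_neq0 ?gamma_neq0 ?th_neq0 //.
  by rewrite pnatr_eq0 -lt0n.
by rewrite -natrD pnatr_eq0 addn2.
Qed.

End StructureRelation.

(** * The coefficients of x^{n-3} and x^{n-6} *)

Section SecondCoefficients.
Variables (K : numFieldType) (P : nat -> {poly K}) (gamma : nat -> K).
Hypothesis P_rec : threefold_recurrence P gamma.
Hypothesis gamma_neq0 : forall n : nat, (1 <= n)%N -> gamma n != 0.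

Let mP : monic_seq P := threefold_recurrence_monic P_rec.
Let coefS n k := threefold_recurrence_coefS n k P_rec.
Let lead n : (P n)`_n = 1 := monic_seq_coef n mP.

Lemma second_coef0 : (P 3)`_0 = - gamma 1%N.
Proof.
case: (P_rec) => P0 _ _ _.
by rewrite (threefold_recurrence_coef0 0 P_rec) P0 coef1 mulr1.
Qed.

Lemma second_coefS j : (P j.+4)`_j.+1 = (P j.+3)`_j - gamma j.+2.
Proof. by rewrite coefS lead mulr1. Qed.

Lemma third_coef0 : (P 6)`_0 = - gamma 4%N * (P 3)`_0.
Proof. by rewrite (threefold_recurrence_coef0 3 P_rec). Qed.

Lemma third_coefS j :
  (P j.+4.+3)`_j.+1 = (P j.+4.+2)`_j - gamma j.+4.+1 * (P j.+4)`_j.+1.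
Proof. exact: coefS. Qed.

Definition gamma_recursion (th : nat -> K) : Prop :=
  forall m, (1 <= m)%N ->
    (m%:R + 1) * gamma m.+2 * ((m%:R + 4) * th m.+1 - (m%:R + 3))
    = (m%:R + 3) * gamma m.+1 * (m%:R * th m - (m%:R - 1)).

(** The first-order relation at m = j+1 and x^j; a predicate of one [j], to serve as induction
    hypothesis. *)
Definition second_coef_formula (th : nat -> K) (j : nat) : Prop :=
  3 * (P j.+3)`_j
  + (j%:R + 1) * gamma j.+2 * ((j%:R + 4) * th j.+1 - (j%:R + 3)) = 0.

(** From j to j+1 the coefficient changes by -gamma_{j+2}, so the two formulas differ by
    [gamma_recursion] at m = j+1. *)
Lemma second_coef_formulaS th j : second_coef_formula th j ->
  (j%:R + 2) * gamma j.+3 * ((j%:R + 5) * th j.+2 - (j%:R + 4))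
    = (j%:R + 4) * gamma j.+2 * ((j%:R + 1) * th j.+1 - j%:R) <->
  second_coef_formula th j.+1.
Proof.
rewrite /second_coef_formula second_coefS => Ej.
rewrite [X in _ <-> X = 0](_ : _ =
  (3 * (P j.+3)`_j + (j%:R + 1) * gamma j.+2 * ((j%:R + 4) * th j.+1 - (j%:R + 3)))
  + ((j%:R + 2) * gamma j.+3 * ((j%:R + 5) * th j.+2 - (j%:R + 4))
     - (j%:R + 4) * gamma j.+2 * ((j%:R + 1) * th j.+1 - j%:R))); last by ring.
by rewrite Ej add0r; split=> [->|/eqP]; [rewrite subrr|rewrite subr_eq0 => /eqP].
Qed.

Section FromStructure.
Variable th : nat -> K.
Hypothesis T : structure_relation P gamma th.
Hypothesis th_neq0 : forall m, (1 <= m)%N -> th m != 0.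

Lemma structure_second_coef j : second_coef_formula th j.
Proof. by apply: (eq_multiple (c := 1) (@T j.+1 j isT)); rewrite lead; ring. Qed.

Lemma structure_third_coef j :
  6 * (P j.+4.+2)`_j
  + (j%:R + 1) * gamma j.+4.+1 * ((j%:R + 7) * th j.+4 - (j%:R + 6)) * (P j.+4)`_j.+1 = 0.
Proof. by apply: (eq_multiple (c := 1) (@T j.+4 j isT)); ring. Qed.

Lemma structure_gamma_recursion : gamma_recursion th.
Proof.
move=> [//|j] _.
have E := (second_coef_formulaS (structure_second_coef j)).2 (structure_second_coef j.+1).
by apply: (eq_multiple (c := 1) E); ring.
Qed.

Lemma structure_theta1 : th 1%N = theta1 gamma.
Proof.
have := structure_second_coef 0; rewrite /second_coef_formula second_coef0 => E.
have g2 := gamma_neq0 (isT : 1 <= 2)%N.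
apply: (eq_multiple (c := (4 * gamma 2%N)^-1) E).
by rewrite /theta1; field.
Qed.

Lemma structure_theta2 : th 2%N = theta2 gamma.
Proof.
have := structure_second_coef 1; rewrite /second_coef_formula second_coefS second_coef0 => E.
have g3 := gamma_neq0 (isT : 1 <= 3)%N.
apply: (eq_multiple (c := (10 * gamma 3%N)^-1) E).
by rewrite /theta2; field.
Qed.

Lemma structure_theta_recursion : theta_recursion th.
Proof.
move=> [//|i] _.
pose cc m := gamma m.+1 * ((m%:R + 3) * th m - (m%:R + 2)).
have S j : 3 * (P j.+3)`_j = - ((j%:R + 1) * cc j.+1).
  by apply: (eq_multiple (c := 1) (structure_second_coef j)); rewrite /cc; ring.
have ccS j : (j%:R + 2) * cc j.+2 = (j%:R + 1) * cc j.+1 + 3 * gamma j.+2.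
  have := S j.+1; rewrite second_coefS mulrBr S => E.
  by apply: (eq_multiple (c := 1) E); ring.
(* Consecutive relations at x^{n-6}, or for i = 0 the constant term of P_6, eliminate those
   coefficients in favour of x^{n-3}. *)
have R : (i%:R + 1) * cc i.+4 * (P i.+4)`_i.+1
         = (i%:R * cc i.+3 + 6 * gamma i.+4) * (P i.+3)`_i.
  case: i => [|j].
    have := structure_third_coef 0; rewrite third_coef0 => E.
    by apply: (eq_multiple (c := 1) E); rewrite /cc; ring.
  have := etrans (structure_third_coef j.+1) (esym (structure_third_coef j)).
  rewrite third_coefS => E.
  by apply: (eq_multiple (c := 1) E); rewrite /cc; ring.
(* [S] and [ccS] leave only [cc] at i+1 and i+3; then gamma_{i+2} and gamma_{i+4} cancel, and
   th_{i+1}, th_{i+3} remain. *)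
have E : (i%:R + 1) * ((i%:R + 3) * cc i.+3 + 3 * gamma i.+4)
           * ((i%:R + 1) * cc i.+1 + 3 * gamma i.+2)
         = (i%:R + 4) * (i%:R * cc i.+3 + 6 * gamma i.+4) * ((i%:R + 1) * cc i.+1).
  have c4 : (i%:R + 3) * cc i.+3 + 3 * gamma i.+4 = (i%:R + 4) * cc i.+4.
    by apply: (eq_multiple (c := -1) (ccS i.+2)); ring.
  rewrite c4 -ccS -[(i%:R + 1) * cc i.+1]opprK -S.
  transitivity (- 3 * (i%:R + 4) * ((i%:R + 1) * cc i.+4 * (P i.+4)`_i.+1)).
    by apply: (eq_multiple (c := (i%:R + 1) * (i%:R + 4) * cc i.+4) (S i.+1)); ring.
  by rewrite R; ring.
have g2 := gamma_neq0 (isT : 1 <= i.+2)%N.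
have g4 := gamma_neq0 (isT : 1 <= i.+4)%N.
apply: (eq_multiple (c := (3 * (i%:R + 1) * (i%:R + 4) * (i%:R + 6)
                            * gamma i.+2 * gamma i.+4)^-1) E).
by rewrite /cc; field; rewrite g2 g4 natr1 -!natrD !pnatr_eq0 !addn_eq0 !andbF.
Qed.

End FromStructure.
End SecondCoefficients.

(** * The third-order differential equation *)

Section DifferentialEquation.
Variables (K : numFieldType) (P : nat -> {poly K}) (gamma : nat -> K).
Hypothesis P_rec : threefold_recurrence P gamma.
Hypothesis gamma_neq0 : forall n : nat, (1 <= n)%N -> gamma n != 0.

Let mP : monic_seq P := threefold_recurrence_monic P_rec.
Let lead n : (P n)`_n = 1 := monic_seq_coef n mP.

Lemma coef_third_order (p : {poly K}) (a b c d : K) k :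
  ((a *: 'X^3 - b%:P) * p^`(3) + c *: 'X^2 * p^`(2) + d *: 'X * p^`())`_k
  = (a * k%:R * (k%:R - 1) * (k%:R - 2) + c * k%:R * (k%:R - 1) + d * k%:R) * p`_k
    - b * (k%:R + 1) * (k%:R + 2) * (k%:R + 3) * p`_k.+3.
Proof.
have d2 : p^`(2) = p^`()^`() by [].
have d3 : p^`(3) = p^`()^`()^`() by [].
rewrite d2 d3 mulrBl -!scalerAl !coefD coefN !coefZ coefCM !coefXnM coefXM.
by case: k => [|[|[|k]]] /=; rewrite ?subSS ?subn0 !coef_deriv; ring.
Qed.

(* The indicial polynomial [a k (k-1) (k-2) + c k (k-1) + d k - e] of the
   equation splits into linear factors. *)
Lemma third_order_equationE n :
  (coef_a gamma n *: 'X^3 - (coef_b gamma n)%:P) * (P n)^`(3)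
    + coef_c gamma n *: 'X^2 * (P n)^`(2)
    + coef_d gamma n *: 'X * (P n)^`()
  = coef_e gamma n *: P n <->
  forall k,
    (n%:R - k%:R) * ((theta gamma n - 1) * k%:R + 1)
      * ((theta gamma n.+1 - 1) * (k%:R + 1) + 1) * (P n)`_k
    + coef_b gamma n * (k%:R + 1) * (k%:R + 2) * (k%:R + 3) * (P n)`_k.+3 = 0.
Proof.
have indicial k :
    coef_a gamma n * k%:R * (k%:R - 1) * (k%:R - 2)
      + coef_c gamma n * k%:R * (k%:R - 1) + coef_d gamma n * k%:R
    = coef_e gamma n
      - (n%:R - k%:R) * ((theta gamma n - 1) * k%:R + 1)
        * ((theta gamma n.+1 - 1) * (k%:R + 1) + 1).
  rewrite /coef_a /coef_c /coef_d /coef_e.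
  by move: (theta gamma n) (theta gamma n.+1) => u v; ring.
have coefE k := coef_third_order (P n) (coef_a gamma n) (coef_b gamma n)
  (coef_c gamma n) (coef_d gamma n) k.
split=> [E k|E].
  move: (coefE k); rewrite E coefZ indicial.
  move: (coef_b gamma n) (coef_e gamma n) (theta gamma n) (theta gamma n.+1).
  by move=> b e u v {}E; apply: (eq_multiple (c := 1) E); ring.
apply/polyP=> k; rewrite coefE coefZ indicial.
move: (E k) => {}E; move: E.
move: (coef_b gamma n) (coef_e gamma n) (theta gamma n) (theta gamma n.+1).
by move=> b e u v {}E; apply: (eq_multiple (c := -1) E); ring.
Qed.

Lemma coef_bE m :
  (m%:R + 2) * (m%:R + 3) * coef_b gamma m.+2
  = gamma m.+2 * ((m%:R + 1) * theta gamma m.+1 - m%:R)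
    * ((m%:R + 2) * theta gamma m.+2 - (m%:R + 1))
    * ((m%:R + 3) * theta gamma m.+3 - (m%:R + 2)).
Proof.
rewrite /coef_b subn1 /=.
move: (theta gamma m.+1) (theta gamma m.+2) (theta gamma m.+3) => t1 t2 t3.
by field; rewrite -natrD natr1 !pnatr_eq0.
Qed.

Lemma theta_recursionE (th : nat -> K) m :
  theta_recursion th -> (1 <= m)%N -> th m != 0 -> th m.+2 = 2 - (th m)^-1.
Proof. by move=> thS m1 nz; apply: (mulIf nz); rewrite thS // mulrBl mulVf. Qed.

(** * From the first-order relation to the differential equation *)

Section FromStructure.
Variable th : nat -> K.
Hypothesis T : structure_relation P gamma th.
Hypothesis th_neq0 : forall m, (1 <= m)%N -> th m != 0.
Hypothesis thS : theta_recursion th.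
Hypothesis gammaS : gamma_recursion gamma th.

Lemma structure_coef_step m k : (1 <= m)%N ->
  (k%:R + 1) * ((m%:R + 3) * th m - (m%:R + 2)) * (P m.+3)`_k.+1
  = (m%:R + 3) * ((k%:R + 1) * th m - k%:R) * (P m.+2)`_k.
Proof.
move=> m1; rewrite (threefold_recurrence_coefS _ _ P_rec).
by apply: (eq_multiple (c := -1) (T k m1)); ring.
Qed.

(** Two uses of [structure_coef_step] lead from P_{m+2} to P_{m+4}; the relation at m+2 returns to
    P_{m+2}, three exponents higher. *)
Lemma structure_third_order_coef m k : (1 <= m)%N ->
  (m%:R + 2) * (m%:R + 3) * (m%:R + 2 - k%:R) * ((th m.+2 - 1) * k%:R + 1)
    * ((th m.+3 - 1) * (k%:R + 1) + 1) * (P m.+2)`_k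
  + gamma m.+2 * ((m%:R + 1) * th m.+1 - m%:R)
    * ((m%:R + 2) * th m.+2 - (m%:R + 1)) * ((m%:R + 3) * th m.+3 - (m%:R + 2))
    * (k%:R + 1) * (k%:R + 2) * (k%:R + 3) * (P m.+2)`_k.+3 = 0.
Proof.
move=> m1; have thm := th_neq0 m1; have thm1 := th_neq0 (leqW m1).
have U1 := structure_coef_step k m1.
have U2 := structure_coef_step k.+1 (leqW m1).
have T3 := T k.+2 (leqW (leqW m1)).
have G := gammaS (leqW m1).
have m4 : m%:R + 4 != 0 :> K by rewrite -natrD pnatr_eq0 addn_eq0 andbF.
pose p0 := (P m.+2)`_k; pose p1 := (P m.+3)`_k.+1; pose p2 := (P m.+4)`_k.+2.
pose p3 := (P m.+2)`_k.+3.
pose A := (m%:R + 3) * ((k%:R + 1) * th m - k%:R).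
pose A' := (m%:R + 4) * ((k%:R + 2) * th m.+1 - (k%:R + 1)).
pose B := (k%:R + 1) * ((m%:R + 3) * th m - (m%:R + 2)).
pose B' := (k%:R + 2) * ((m%:R + 4) * th m.+1 - (m%:R + 3)).
pose C := (k%:R + 3) * ((m%:R + 5) * th m.+2 - (m%:R + 4)).
have E : (m%:R + 2 - k%:R) * A * A' * p0 + B * B' * C * gamma m.+3 * p3 = 0.
  have E1 : A * p0 = B * p1 by rewrite /A /B -U1.
  have E2 : A' * p1 = B' * p2.
    by apply: (eq_multiple (c := -1) U2); rewrite /A' /B' /p1 /p2; ring.
  have E3 : (m%:R + 2 - k%:R) * p2 + C * gamma m.+3 * p3 = 0.
    by apply: (eq_multiple (c := 1) T3); rewrite /C /p2 /p3; ring.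
  clearbody A A' B B' C p0 p1 p2 p3.
  transitivity ((m%:R + 2 - k%:R) * A' * (A * p0) + B * B' * C * gamma m.+3 * p3).
    by ring.
  rewrite E1.
  transitivity ((m%:R + 2 - k%:R) * B * (A' * p1) + B * B' * C * gamma m.+3 * p3).
    by ring.
  rewrite E2; apply: (eq_multiple (c := B * B') E3).
  by ring.
(* The gamma recursion trades gamma_{m+3} for gamma_{m+2}. *)
have CG : (m%:R + 2) * C * gamma m.+3
    = (k%:R + 3) * (m%:R + 4) * gamma m.+2 * ((m%:R + 1) * th m.+1 - m%:R).
  by apply: (eq_multiple (c := k%:R + 3) G); rewrite /C; ring.
have {}E : (m%:R + 2) * (m%:R + 2 - k%:R) * A * A' * p0
    + B * B' * ((k%:R + 3) * (m%:R + 4) * gamma m.+2 * ((m%:R + 1) * th m.+1 - m%:R)) * p3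
    = 0.
  rewrite -CG; apply: (eq_multiple (c := m%:R + 2) E).
  by clearbody A A' B B' C p0 p3; ring.
(* Since th_{m+2} = 2 - 1/th_m, one has (k+1) th_m - k = th_m ((th_{m+2} - 1) k + 1); the other
   factors behave alike, and th_m th_{m+1} cancels. *)
rewrite (theta_recursionE thS m1 thm) (theta_recursionE thS (leqW m1) thm1) -/p0 -/p3.
apply: (eq_multiple (c := ((m%:R + 4) * th m * th m.+1)^-1) E).
rewrite /A /A' /B /B'; clearbody p0 p3; field.
by rewrite thm thm1.
Qed.

End FromStructure.

(** * From the differential equation to the first-order relation *)

Section ToStructure.
Variable th : nat -> K.
Hypothesis th1 : th 1%N = theta1 gamma.
Hypothesis th_neq0 : forall m, (1 <= m)%N -> th m != 0.
Hypothesis thS : theta_recursion th.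
Hypothesis shift0 : forall m, (1 <= m)%N -> m%:R * th m - (m%:R - 1) != 0.
Hypothesis shift3 : forall m, (1 <= m)%N -> (m%:R + 3) * th m - (m%:R + 2) != 0.

Lemma second_coef_formula0 : second_coef_formula P gamma th 0.
Proof.
rewrite /second_coef_formula (second_coef0 P_rec) th1 /theta1.
by field; exact: gamma_neq0.
Qed.

Lemma gamma_recursion_second_coef :
  gamma_recursion gamma th -> forall j, second_coef_formula P gamma th j.
Proof.
move=> gammaS; elim=> [|j IH]; first exact: second_coef_formula0.
apply: (second_coef_formulaS P_rec IH).1.
by apply: (eq_multiple (c := 1) (gammaS j.+1 isT)); ring.
Qed.

(** The hypothesis is the equation at x^{n-3}, n = j+3. The second coefficient formula at j turns it
    into the recursion for gamma_{j+3}, which gives the formula at j+1. *)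
Lemma third_order_coef_gamma_recursion :
  (forall j,
    (j%:R + 3) * (j%:R + 4) * 3 * ((th j.+3 - 1) * j%:R + 1)
      * ((th j.+4 - 1) * (j%:R + 1) + 1) * (P j.+3)`_j
    + gamma j.+3 * ((j%:R + 2) * th j.+2 - (j%:R + 1))
      * ((j%:R + 3) * th j.+3 - (j%:R + 2)) * ((j%:R + 4) * th j.+4 - (j%:R + 3))
      * (j%:R + 1) * (j%:R + 2) * (j%:R + 3) = 0) ->
  gamma_recursion gamma th.
Proof.
move=> E.
have step j : second_coef_formula P gamma th j ->
    (j%:R + 2) * gamma j.+3 * ((j%:R + 5) * th j.+2 - (j%:R + 4))
    = (j%:R + 4) * gamma j.+2 * ((j%:R + 1) * th j.+1 - j%:R).
  move=> Fj; have Ej := E j; have t1 := @th_neq0 j.+1 isT; have t2 := @th_neq0 j.+2 isT.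
  have s3 : (j%:R + 4) * th j.+1 - (j%:R + 3) != 0.
    by move: (@shift3 j.+1 isT); congr (_ != 0); ring.
  have s0 : (j%:R + 2) * th j.+2 - (j%:R + 1) != 0.
    by move: (@shift0 j.+2 isT); congr (_ != 0); ring.
  rewrite (theta_recursionE (m := j.+1) thS isT t1) in Ej.
  rewrite (theta_recursionE (m := j.+2) thS isT t2) in Ej.
  apply: (eq_multiple2
    (c := th j.+1 * th j.+2 / ((j%:R + 3) * (j%:R + 1)
            * ((j%:R + 4) * th j.+1 - (j%:R + 3)) * ((j%:R + 2) * th j.+2 - (j%:R + 1))))
    (d := - ((j%:R + 4) * ((j%:R + 1) * th j.+1 - j%:R))
            / ((j%:R + 1) * ((j%:R + 4) * th j.+1 - (j%:R + 3))))
    Ej Fj).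
  by field; rewrite t1 t2 s0 s3 natr1 -natrD !pnatr_eq0 addn_eq0 andbF.
have F j : second_coef_formula P gamma th j.
  elim: j => [|j IH]; first exact: second_coef_formula0.
  exact: (second_coef_formulaS P_rec IH).1 (step _ IH).
by move=> [//|j] _; apply: (eq_multiple (c := 1) (step j (F j))); ring.
Qed.

(** In this range P_{m+2} enters only through its x^{n-3}, missing, leading or excessive
    coefficients. *)
Lemma structure_relation_top m k :
  (forall j, second_coef_formula P gamma th j) -> (1 <= m)%N -> (m <= k.+1)%N ->
  (m%:R + 2 - k%:R) * (P m.+2)`_k
  + k.+1%:R * gamma m.+1 * ((m%:R + 3) * th m - (m%:R + 2)) * (P m)`_k.+1 = 0.
Proof.
case: m => // m F _; rewrite ltnS leq_eqVlt => /predU1P[<-|lt_mk].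
  by rewrite lead; apply: (eq_multiple (c := 1) (F m)); ring.
rewrite [(P m.+1)`_k.+1](monic_seq_coef0 (n := m.+1) (k := k.+1) mP lt_mk) mulr0 addr0.
have [_ sub2] := threefold_recurrence_subleading m.+1 P_rec.
have [sub1 _] := threefold_recurrence_subleading m.+2 P_rec.
move: lt_mk; rewrite leq_eqVlt => /predU1P[<-|]; first by rewrite sub2 mulr0.
rewrite leq_eqVlt => /predU1P[<-|]; first by rewrite sub1 mulr0.
rewrite leq_eqVlt => /predU1P[<-|lt_k]; first by ring.
by rewrite (monic_seq_coef0 mP lt_k) mulr0.
Qed.

Theorem gamma_recursion_structure :
  gamma_recursion gamma th -> structure_relation P gamma th.
Proof.
move=> gammaS; have F := gamma_recursion_second_coef gammaS.
case: (P_rec) => P0 P1 P2 _.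
(* For m = 2, 3, where the induction cannot reach back to m-3 >= 1, the coefficients involved all
   vanish. *)
have P40 : (P 4)`_0 = 0 by rewrite (threefold_recurrence_coef0 1 P_rec) P1 coefX /= mulr0.
have P50 : (P 5)`_0 = 0 by rewrite (threefold_recurrence_coef0 2 P_rec) P2 coefXn /= mulr0.
have P51 : (P 5)`_1 = 0.
  by rewrite (threefold_recurrence_coefS 2 0 P_rec) P40 P2 coefXn /= mulr0 subrr.
move=> m; elim/ltn_ind: m => m IH k m1.
have [le_mk|lt_km] := leqP m k.+1; first exact: structure_relation_top.
case: m IH m1 lt_km => [|[|[|[|m]]]] // IH _ lt_km.
- by case: k lt_km => // _; rewrite P40 P2 coefXn /= !mulr0 addr0.
- case: k lt_km => [|[|//]] _.
    by rewrite P50 (threefold_recurrence_subleading 1 P_rec).2 !mulr0 addr0.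
  by rewrite P51 (threefold_recurrence_subleading 2 P_rec).1 !mulr0 addr0.
have {lt_km} Tm := IH m.+1 (ltac:(lia)) k isT.
(* The relation at m+3 reduces P_{m+6} to P_{m+3}; [Tm] does the same for P_{m+4}, and the gamma
   recursion matches the results. *)
have top : (m%:R + 6 - k%:R) * (P m.+4.+2)`_k
    = - (k%:R * gamma m.+4 * ((m%:R + 6) * th m.+3 - (m%:R + 5))
         + (m%:R + 6 - k%:R) * gamma m.+4) * (P m.+3)`_k.
  case: k {Tm} => [|k].
    by rewrite (threefold_recurrence_coef0 m.+3 P_rec); ring.
  rewrite (threefold_recurrence_coefS m.+3 k P_rec).
  by apply: (eq_multiple (c := 1) (IH m.+3 (ltac:(lia)) k isT)); ring.
have s3 : (m%:R + 4) * th m.+1 - (m%:R + 3) != 0.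
  by move: (@shift3 m.+1 isT); congr (_ != 0); ring.
have t1 := @th_neq0 m.+1 isT; have G := gammaS m.+3 isT.
rewrite (theta_recursionE (m := m.+1) thS isT t1) in G top.
rewrite [(P m.+4)`_k.+1](threefold_recurrence_coefS m.+1 k P_rec).
have -> : m.+4%:R + 2 - k%:R = m%:R + 6 - k%:R :> K by ring.
rewrite top.
apply: (eq_multiple2
  (c := - gamma m.+4.+1 * ((m%:R + 7) * th m.+4 - (m%:R + 6))
          / ((m%:R + 4) * th m.+1 - (m%:R + 3)))
  (d := (P m.+3)`_k * ((k%:R + 1) * th m.+1 - k%:R)
          / ((m%:R + 4) * th m.+1 - (m%:R + 3)))
  Tm G).
by field; rewrite t1 s3.
Qed.

End ToStructure.

Theorem hahn_classical_third_order : two_orthogonal P ->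
  hahn_classical P <->
  [/\ ~ excluded_value (theta1 gamma),
      ~ excluded_value (theta2 gamma)
    & forall n : nat, (1 <= n)%N ->
        (coef_a gamma n *: 'X^3 - (coef_b gamma n)%:P) * (P n)^`(3)
        + coef_c gamma n *: 'X^2 * (P n)^`(2)
        + coef_d gamma n *: 'X * (P n)^`()
        = coef_e gamma n *: P n].
Proof.
move=> P_orth; rewrite (hahn_classicalP P_rec gamma_neq0 P_orth); split.
  case=> th T th_neq0.
  have th1 := structure_theta1 P_rec gamma_neq0 T.
  have th2 := structure_theta2 P_rec gamma_neq0 T.
  have thS := structure_theta_recursion P_rec gamma_neq0 T.
  have gammaS := structure_gamma_recursion P_rec T.
  have [n1 n2 thE] := theta_unique th1 th2 th_neq0 thS.
  split=> // -[|[|[|m]]] // _; apply/third_order_equationE => k.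
  (* For n = 1, 2, P_n = x^n: the b_n term drops, and the factor n - k vanishes at k = n. *)
  - case: (P_rec) => _ -> _ _; rewrite !coefX.
    by case: k => [|[|k]] /=; rewrite ?mulr0 ?addr0 // subrr !mul0r.
  - case: (P_rec) => _ _ -> _; rewrite !coefXn.
    by case: k => [|[|[|k]]] /=; rewrite ?mulr0 ?addr0 // subrr !mul0r.
  have H := structure_third_order_coef T th_neq0 thS gammaS k (isT : 1 <= m.+1)%N.
  have := coef_bE m.+1; rewrite -!thE // => B; move: (coef_b gamma m.+3) B => b B.
  apply: (eq_multiple2 (c := ((m%:R + 3) * (m%:R + 4))^-1)
    (d := (k%:R + 1) * (k%:R + 2) * (k%:R + 3) * (P m.+3)`_k.+3
            / ((m%:R + 3) * (m%:R + 4))) H B).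
  by field; rewrite -!natrD !pnatr_eq0 !addn_eq0 !andbF.
case=> n1 n2 E; exists (theta gamma); last exact: theta_neq0.
have th1 : theta gamma 1 = theta1 gamma by rewrite (theta_odd gamma 0) moebius_orbit0.
have th_neq0 := theta_neq0 n1 n2; have thS := thetaS n1 n2.
have s0 := theta_shift0_neq0 n1 n2; have s3 := theta_shift3_neq0 n1 n2.
apply: gamma_recursion_structure => //.
apply: third_order_coef_gamma_recursion => // j.
(* Only x^{n-3} is used, where the b_n term carries the leading coefficient 1. *)
have := (third_order_equationE j.+3).1 (E j.+3 isT) j; rewrite lead.
have := coef_bE j.+1; move: (coef_b gamma j.+3) => b.
move: (theta gamma j.+2) (theta gamma j.+3) (theta gamma j.+4) => t2 t3 t4 B H.
by apply: (eq_multiple2 (c := (j%:R + 3) * (j%:R + 4))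
  (d := - ((j%:R + 1) * (j%:R + 2) * (j%:R + 3))) H B); ring.
Qed.

End DifferentialEquation.

Theorem proposition3p5 (R : realType) (P : nat -> {poly R[i]})
    (gamma : nat -> R[i])
    (P_orth : two_orthogonal P)
    (P_sym : threefold_symmetric P)
    (P_rec : threefold_recurrence P gamma)
    (gamma_neq0 : forall n : nat, (1 <= n)%N -> gamma n != 0) :
  hahn_classical P <->
  [/\ ~ excluded_value (theta1 gamma),
      ~ excluded_value (theta2 gamma)
    & forall n : nat, (1 <= n)%N ->
        (coef_a gamma n *: 'X^3 - (coef_b gamma n)%:P) * (P n)^`(3)
        + coef_c gamma n *: 'X^2 * (P n)^`(2)
        + coef_d gamma n *: 'X * (P n)^`()
        = coef_e gamma n *: P n].
Proof. exact: hahn_classical_third_order. Qed.
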